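(* Let $E$ and $F$ be Banach lattices. The following spaces of operators satisfy the domination property: (i) $[\mathrm{PSP}](E,F)$; (ii) $[\mathrm{DPSP}](E,F)$; (iii) $[\mathrm{DDSP}](E,F)$, under the assumption that $F$ has property (d); (iv) $[\mathrm{PGP}](E,F)$; (v) $[\mathrm{DGP}](E,F)$, under the assumption that $F$ has property (d); (vi) $[\mathrm{dswl}](E,F)$; (vii) $[\mathrm{swl}](E,F)$, under the assumption that $E$ has sequentially weakly continuous lattice operations; (viii) $[\mathrm{sw}^*\mathrm{l}](E,F)$, under the assumption that $F'$ has sequentially weak$^*$-continuous lattice operations; (ix) $[\mathrm{d}](E,F)$, under the assumption that $F$ has property (d); (x) $[\text{bi-sP}](E,F)$.
   Context: All vector spaces are real; operators are linear and bounded. $E,F$ are Banach lattices with norm duals $E',F'$; $E_+$, $F'_+$ denote positive cones; $\mathrm{L}(E,F)$ is the space of bounded operators; $S\le T$ means $T-S$ is positive. ''w-null'' means weakly convergent to $0$; ''w$^*$-null'' means weak$^*$ convergent to $0$ in a dual space. A sequence $(x_n)$ in a Banach lattice is disjoint if $|x_n|\wedge|x_m|=0$ for $n\ne m$. $T'$ is the adjoint of $T$. A set $\mathcal{P}\subseteq\mathrm{L}(E,F)$ satisfies the domination property if, for all $S,T\in \mathrm{L}(E,F)$, $0\le S\le T\in\mathcal{P}$ implies $S\in\mathcal{P}$. $E$ has sequentially weakly continuous lattice operations if $(|x_n|)$ is w-null for each w-null $(x_n)$ in $E$. $F'$ has sequentially weak$^*$-continuous lattice operations if $(|f_n|)$ is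 w$^*$-null for each w$^*$-null $(f_n)$ in $F'$. $F$ has property (d) if $(|f_n|)$ is w$^*$-null for each disjoint w$^*$-null sequence $(f_n)$ in $F'$. An operator $T:E\to F$ is: - a $[\mathrm{PSP}]$-operator if $\|Tx_n\|\to0$ for each w-null $(x_n)$ in $E_+$; - a $[\mathrm{DPSP}]$-operator if $\|T'f_n\|\to 0$ for each w$^*$-null $(f_n)$ in $F'_+$; - a $[\mathrm{DDSP}]$-operator if $\|T'f_n\|\to 0$ for each disjoint w$^*$-null $(f_n)$ in $F'$; - a $[\mathrm{PGP}]$-operator if $(T'f_n)$ is w-null for each w$^*$-null $(f_n)$ in $F'_+$; - a $[\mathrm{DGP}]$-operator if $(T'f_n)$ is w-null for each disjoint w$^*$-null $(f_n)$ in $F'$; - a $[\mathrm{dswl}]$-operator if $(|Tx_n|)$ is w-null for each disjoint w-null $(x_n)$ in $E$; - an $[\mathrm{swl}]$-operator if $(|Tx_n|)$ is w-null for each w-null $(x_n)$ in $E$; - an $[\mathrm{sw}^*\mathrm{l}]$-operator if $(|T'f_n|)$ is w$^*$-null for each w$^*$-null $(f_n)$ in $F'$; - a $[\mathrm{d}]$-operator if $(|T'f_n|)$ is w$^*$-null for each disjoint w$^*$-null $(f_n)$ in $F'$; - a $[\text{bi-sP}]$-operator if $f_n(Tx_n)\to0$ for each w$^*$-null $(f_n)$ in $F'_+$ and each disjoint w-null $(x_n)$ in $E$. For each class, $[\,\cdot\,](E,F)$ denotes the set of all such operators in $\mathrm{L}(E,F)$. *)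

(* Defs.v *)
From HB Require Import structures.
From mathcomp Require Import all_boot all_order all_algebra.
From mathcomp Require Import all_classical all_reals topology normedtype sequences.
From mathcomp Require Import lra.

Set Implicit Arguments.
Unset Strict Implicit.
Unset Printing Implicit Defensive.

Import Order.TTheory GRing.Theory Num.Theory.
Import numFieldNormedType.Exports.

Local Open Scope classical_set_scope.
Local Open Scope ring_scope.

(* The order is a field of the mixin, rather than an inherited [Order.Lattice]
   at [ring_display], because [numDomainType] already joins order and norm and
   leaves no room for a second join in the hierarchy. The order structures are
   attached to every Banach lattice right after, so that [<=], [Order.meet],
   [Order.join] and the theory of [latticeType] apply to its elements. *)
HB.mixin Record isBanachLattice (R : realType) E & CompleteNormedModule R E := {
  bl_le : rel E;
  bl_join : E -> E -> E;
  bl_meet : E -> E -> E;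
  bl_refl : reflexive bl_le;
  bl_anti : antisymmetric bl_le;
  bl_trans : transitive bl_le;
  bl_leUx : forall x y z, bl_le (bl_join x y) z = bl_le x z && bl_le y z;
  bl_lexI : forall x y z, bl_le x (bl_meet y z) = bl_le x y && bl_le x z;
  bl_leD2r : forall z x y, bl_le x y -> bl_le (x + z) (y + z);
  bl_scale_ge0 : forall (a : R) x, 0 <= a -> bl_le 0 x -> bl_le 0 (a *: x);
  bl_norm_le : forall x y,
    bl_le (bl_join x (- x)) (bl_join y (- y)) -> `|x| <= `|y|
}.

#[short(type="banachLatticeType")]
HB.structure Definition BanachLattice (R : realType) :=
  {E of CompleteNormedModule R E & isBanachLattice R E}.

Section banach_lattice_order.
Variables (R : realType) (E : banachLatticeType R).

#[non_forgetful_inheritance]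
HB.instance Definition _ :=
  Order.Le_isPOrder.Build ring_display (BanachLattice.sort E)
    (@bl_refl R E) (@bl_anti R E) (@bl_trans R E).
#[non_forgetful_inheritance]
HB.instance Definition _ :=
  Order.POrder_isJoinSemilattice.Build ring_display (BanachLattice.sort E)
    (@bl_leUx R E).
#[non_forgetful_inheritance]
HB.instance Definition _ :=
  Order.POrder_isMeetSemilattice.Build ring_display (BanachLattice.sort E)
    (@bl_lexI R E).

End banach_lattice_order.

Definition modulus (R : realType) (E : banachLatticeType R) (x : E) : E :=
  Order.join x (- x).

Section banach_lattice_theory.
Variables (R : realType) (E : banachLatticeType R).
Implicit Types (x y z u v : E) (a : R).

Lemma blat_leD2r z x y : (x + z <= y + z) = (x <= y).
Proof.
apply/idP/idP; last exact: (@bl_leD2r R E).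
by move=> /(@bl_leD2r R E (- z)); rewrite !addrK.
Qed.

Lemma blat_leD2l z x y : (z + x <= z + y) = (x <= y).
Proof. by rewrite ![z + _]addrC blat_leD2r. Qed.

Lemma blat_leD x y u v : x <= y -> u <= v -> x + u <= y + v.
Proof.
by move=> xy uv; apply: (@le_trans _ _ (y + u)); rewrite ?blat_leD2r ?blat_leD2l.
Qed.

Lemma blat_subr_ge0 x y : (0 <= y - x) = (x <= y).
Proof. by rewrite -(blat_leD2r x 0) add0r subrK. Qed.

Lemma blat_leN2 x y : (- x <= - y) = (y <= x).
Proof. by rewrite -(blat_subr_ge0 (- x)) opprK addrC blat_subr_ge0. Qed.

Lemma blat_oppr_le0 x : (- x <= 0) = (0 <= x).
Proof. by rewrite -{1}oppr0 blat_leN2. Qed.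

Lemma blat_lerBlDr x y z : (x - y <= z) = (x <= z + y).
Proof. by rewrite -[LHS](blat_leD2r y) subrK. Qed.

Lemma blat_addr_ge0 x y : 0 <= x -> 0 <= y -> 0 <= x + y.
Proof. by move=> x0 y0; rewrite -[0]addr0 blat_leD. Qed.

Lemma blat_scaler_ge0 a x : 0 <= a -> 0 <= x -> 0 <= a *: x.
Proof. exact: (@bl_scale_ge0 R E). Qed.

Lemma blat_scaler_le a x y : 0 <= a -> x <= y -> a *: x <= a *: y.
Proof.
by move=> a0; rewrite -blat_subr_ge0 -[a *: x <= _]blat_subr_ge0 -scalerBr;
  exact: blat_scaler_ge0.
Qed.

Lemma blat_joinD x y z : Order.join (x + z) (y + z) = Order.join x y + z.
Proof.
apply/le_anti/andP; split.
  by rewrite leUx !blat_leD2r leUl leUr.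
rewrite -(blat_leD2r (- z)) addrK leUx.
by rewrite -(blat_leD2r z x) -(blat_leD2r z y) !subrK leUl leUr.
Qed.

Definition pos_part x : E := Order.join x 0.
Definition neg_part x : E := pos_part (- x).

Lemma pos_part_ge0 x : 0 <= pos_part x. Proof. exact: leUr. Qed.
Lemma neg_part_ge0 x : 0 <= neg_part x. Proof. exact: leUr. Qed.
Hint Resolve pos_part_ge0 neg_part_ge0 : core.

Lemma pos_partB x : pos_part x - neg_part x = x.
Proof.
apply/eqP; rewrite subr_eq [x + _]addrC /pos_part.
by rewrite -blat_joinD addNr add0r joinC.
Qed.

Lemma blat_half x : 2^-1 *: (x + x) = x.
Proof.
have e : 2^-1 + 2^-1 = 1 :> R by rewrite [RHS]splitr mul1r.
by rewrite scalerDr -scalerDl e scale1r.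
Qed.

Lemma modulus_ge0 x : 0 <= modulus x.
Proof.
have h : 0 <= modulus x + modulus x.
  by rewrite -(subrr x) blat_leD// ?leUl ?leUr.
by rewrite -(blat_half (modulus x)) blat_scaler_ge0// invr_ge0.
Qed.

Lemma modulus_ge x : x <= modulus x. Proof. exact: leUl. Qed.
Lemma modulus_geN x : - x <= modulus x. Proof. exact: leUr. Qed.

Lemma modulusN x : modulus (- x) = modulus x.
Proof. by rewrite /modulus opprK joinC. Qed.

Lemma ge0_modulus x : 0 <= x -> modulus x = x.
Proof.
move=> x0; apply/join_idPl.
by apply: (@le_trans _ _ 0) => //; rewrite blat_oppr_le0.
Qed.

Lemma modulus_le_norm x y : modulus x <= modulus y -> `|x| <= `|y|.
Proof. exact: (@bl_norm_le R E). Qed.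

Lemma norm_modulus x : `|modulus x| = `|x|.
Proof.
by apply/le_anti/andP; split; apply: modulus_le_norm;
  rewrite (ge0_modulus (modulus_ge0 _)).
Qed.

Lemma blat_norm_le_abs x y : x <= y -> - x <= y -> `|x| <= `|y|.
Proof.
move=> xy nxy; apply: modulus_le_norm; apply: le_trans (modulus_ge y).
by rewrite leUx xy.
Qed.

Lemma blat_norm_le x y : 0 <= x -> x <= y -> `|x| <= `|y|.
Proof.
move=> x0 xy; apply: blat_norm_le_abs => //; apply: le_trans xy.
by apply: (@le_trans _ _ 0); rewrite ?blat_oppr_le0.
Qed.

Lemma norm_pos_part x : `|pos_part x| <= `|x|.
Proof.
by rewrite -[leRHS]norm_modulus blat_norm_le// leUx modulus_ge modulus_ge0.
Qed.

Lemma norm_neg_part x : `|neg_part x| <= `|x|.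
Proof. by rewrite -[leRHS]normrN norm_pos_part. Qed.

Lemma modulusE x : modulus x = pos_part x + neg_part x.
Proof.
have -> : pos_part x + neg_part x = pos_part x + pos_part x - x.
  by rewrite -addrA -[X in _ = _ + (_ - X)]pos_partB opprB [_ + (_ - _)]addrC subrK.
have -> : modulus x = Order.join (x + x) 0 - x.
  by rewrite -blat_joinD addrK add0r.
congr (_ - _); apply/le_anti/andP; split.
  by rewrite leUx blat_leD ?leUl// blat_addr_ge0.
have le2 w : w + w <= Order.join (x + x) 0 ->
   w <= 2^-1 *: Order.join (x + x) 0.
  by move=> h; rewrite -{1}(blat_half w) blat_scaler_le// invr_ge0.
have h : pos_part x <= 2^-1 *: Order.join (x + x) 0.
  by rewrite leUx !le2// ?addr0 ?leUl ?leUr.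
apply: le_trans (blat_leD h h) _.
by rewrite -scalerDr blat_half.
Qed.

Lemma riesz_decomposition x y z : 0 <= x -> 0 <= y -> 0 <= z -> z <= x + y ->
  exists2 u, 0 <= u <= x & 0 <= z - u <= y.
Proof.
move=> x0 y0 z0 zxy; exists (Order.meet z x).
  by rewrite lexI z0 x0 leIr.
rewrite blat_subr_ge0 leIl/= blat_lerBlDr addrC -blat_lerBlDr lexI.
by rewrite !blat_lerBlDr zxy andbT -{1}[z]addr0 blat_leD2l.
Qed.

End banach_lattice_theory.

Section bounded_operators.
Variables (R : realType) (E F : normedModType R).

(* [bounded_fun_norm] asks for boundedness on every ball, which for a linear map
   is the usual estimate [`|T x| <= M * `|x|]: see [bounded_linearP]. *)
Definition bounded_linear : {pred E -> F} :=
  mem [set T : E -> F | linear T /\ bounded_fun_norm T].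

Lemma bounded_linearP (T : E -> F) : T \in bounded_linear <->
  linear T /\ exists2 M, 0 <= M & forall x, `|T x| <= M * `|x|.
Proof.
rewrite inE /=; split=> -[linT bT]; split=> //.
  have T0 : T 0 = 0.
    by have := linT (-1) 0 0; rewrite scaleN1r oppr0 addr0 scaleN1r addNr.
  have TZ a x : T (a *: x) = a *: T x.
    by have := linT a x 0; rewrite T0 !addr0.
  have [M MT] := bT 1; exists `|M| => // x.
  have [->|x0] := eqVneq x 0; first by rewrite T0 !normr0 mulr0.
  have nx : 0 < `|x| by rewrite normr_gt0.
  rewrite -ler_pdivrMr// mulrC -{1}(ger0_norm (ltW nx)) -normfV -normrZ -TZ.
  apply: le_trans (ler_norm M); apply: MT.
  by rewrite normrZ normfV normr_id mulVf// gt_eqF.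
move: bT => [M M0 MT] r; exists (M * r) => x xr.
by apply: le_trans (MT x) _; exact: ler_wpM2l.
Qed.

Lemma bounded_linear_submod : submod_closed bounded_linear.
Proof.
split=> [|a S T /bounded_linearP[linS [M M0 MS]] /bounded_linearP[linT [N N0 NT]]].
  apply/bounded_linearP; split=> [a x y|]; first by rewrite /= scaler0 addr0.
  by exists 0 => // x; rewrite normr0 mul0r.
apply/bounded_linearP; split=> [b x y|].
  rewrite -[LHS]/(a *: S (b *: x + y) + T (b *: x + y)).
  rewrite -[in RHS]/(a *: S x + T x) -/(a *: S y + T y).
  rewrite linS linT !scalerDr !scalerA [b * a]mulrC -!addrA; congr (_ + _).
  by rewrite addrCA.
exists (`|a| * M + N) => [|x]; first by rewrite addr_ge0// mulr_ge0.
apply: le_trans (ler_normD _ _) _; rewrite normrZ mulrDl -mulrA lerD//.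
by rewrite ler_wpM2l.
Qed.

HB.instance Definition _ :=
  GRing.isSubmodClosed.Build R (E -> F) bounded_linear bounded_linear_submod.

Record bop := Bop { bop_fun :> E -> F ; bop_subproof : bop_fun \in bounded_linear }.

HB.instance Definition _ := [isSub for bop_fun].
HB.instance Definition _ := [Choice of bop by <:].
HB.instance Definition _ := [SubChoice_isSubLmodule of bop by <:].

Implicit Types (S T : bop) (x y : E).

Lemma bop_linear T : linear T.
Proof. by have /bounded_linearP[] := bop_subproof T. Qed.

HB.instance Definition _ T := GRing.isLinear.Build R E F _ T (bop_linear T).

Lemma bop0 T : T 0 = 0. Proof. exact: linear0. Qed.
Lemma bopD T x y : T (x + y) = T x + T y. Proof. exact: linearD. Qed.
Lemma bopN T x : T (- x) = - T x. Proof. exact: linearN. Qed.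
Lemma bopB T x y : T (x - y) = T x - T y. Proof. exact: linearB. Qed.
Lemma bopZ T a x : T (a *: x) = a *: T x. Proof. exact: linearZ. Qed.

Lemma bop_ext S T : S =1 T -> S = T.
Proof. by move=> ST; apply: val_inj; apply/funext. Qed.

Lemma bop_addE S T x : (S + T) x = S x + T x. Proof. by []. Qed.
Lemma bop_oppE T x : (- T) x = - T x. Proof. by []. Qed.
Lemma bop_subE S T x : (S - T) x = S x - T x. Proof. by []. Qed.
Lemma bop_scaleE a T x : (a *: T) x = a *: T x. Proof. by []. Qed.
Lemma bop_zeroE x : (0 : bop) x = 0. Proof. by []. Qed.

Definition opnorm T : R := sup [set `|T x| | x in [set x | `|x| <= 1]].

Lemma opnorm_has_sup T : has_sup [set `|T x| | x in [set x | `|x| <= 1]].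
Proof.
split; first by exists `|T 0|, 0 => //=; rewrite normr0.
have /bounded_linearP[_ [M M0 MT]] := bop_subproof T.
exists M => _ [x /= x1 <-]; apply: le_trans (MT x) _.
by rewrite -[leRHS]mulr1 ler_wpM2l.
Qed.

Lemma opnorm_ge0 T : 0 <= opnorm T.
Proof.
apply: (@le_trans _ _ `|T 0|) => //; apply: sup_upper_bound.
  exact: opnorm_has_sup.
by exists 0 => //=; rewrite normr0.
Qed.

Lemma opnormP T x : `|T x| <= opnorm T * `|x|.
Proof.
have [->|x0] := eqVneq x 0; first by rewrite linear0 !normr0 mulr0.
have nx : 0 < `|x| by rewrite normr_gt0.
rewrite -ler_pdivrMr// mulrC -{1}(ger0_norm (ltW nx)) -normfV -normrZ -linearZ.
apply: sup_upper_bound; first exact: opnorm_has_sup.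
exists (`|x|^-1 *: x) => //=.
by rewrite normrZ normfV normr_id mulVf// gt_eqF.
Qed.

Lemma opnorm_le T M : 0 <= M -> (forall x, `|T x| <= M * `|x|) -> opnorm T <= M.
Proof.
move=> M0 MT; apply: ge_sup; first by have [] := opnorm_has_sup T.
move=> _ [x /= x1 <-]; apply: le_trans (MT x) _.
by rewrite -[leRHS]mulr1 ler_wpM2l.
Qed.

Lemma opnormD S T : opnorm (S + T) <= opnorm S + opnorm T.
Proof.
apply: opnorm_le => [|x]; first by rewrite addr_ge0 ?opnorm_ge0.
by rewrite mulrDl (le_trans (ler_normD _ _))// lerD// opnormP.
Qed.

Lemma opnormZ_le a T : opnorm (a *: T) <= `|a| * opnorm T.
Proof.
apply: opnorm_le => [|x]; first by rewrite mulr_ge0 ?opnorm_ge0.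
by rewrite bop_scaleE normrZ -mulrA ler_wpM2l// opnormP.
Qed.

Lemma opnormZ a T : opnorm (a *: T) = `|a| * opnorm T.
Proof.
apply/le_anti; rewrite opnormZ_le/=.
have [->|a0] := eqVneq a 0; first by rewrite normr0 mul0r opnorm_ge0.
have := opnormZ_le a^-1 (a *: T).
by rewrite scalerA mulVf// scale1r normfV ler_pdivlMl// normr_gt0.
Qed.

Lemma opnorm0_eq0 T : opnorm T = 0 -> T = 0.
Proof.
move=> T0; apply: bop_ext => x; apply/eqP; rewrite -normr_le0.
by rewrite (le_trans (opnormP T x))// T0 mul0r.
Qed.

HB.instance Definition _ :=
  Lmodule_isNormed.Build R bop opnormD opnormZ opnorm0_eq0.

Lemma bop_norm_le T x : `|T x| <= `|T| * `|x|.
Proof. exact: opnormP. Qed.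

End bounded_operators.

Section bop_complete.
Variables (R : realType) (E : normedModType R) (F : completeNormedModType R).

Lemma bop_cauchy_cvg (G : set_system (bop E F)) :
  ProperFilter G -> cauchy G -> cvg G.
Proof.
move=> FG /cauchyP cG; apply/cvg_ex.
have Gapp e : 0 < e -> exists T : bop E F, \forall S \near G, `|T - S| <= e.
  move=> e0; have [T GT] := cG _ e0.
  by exists T; apply: filterS GT => S; rewrite -ball_normE /= => /ltW.
have cvgx x : cvg ((fun S : bop E F => S x) @ G).
  apply: cauchy_cvg; apply/cauchyP => e e0.
  have x1 : 0 < `|x| + 1 by rewrite ltr_wpDl.
  have [T GT] := Gapp _ (divr_gt0 (divr_gt0 e0 (ltr0Sn R 1)) x1).
  exists (T x); rewrite /= nbhs_filterE /fmap /=.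
  near=> S; rewrite /= -ball_normE /= -bop_subE.
  have TS : `|T - S| <= e / 2 / (`|x| + 1) by near: S.
  apply: (@le_lt_trans _ _ (e / 2)); last first.
    by rewrite ltr_pdivrMr// ltr_pMr// ltr1n.
  apply: le_trans (bop_norm_le _ _) _.
  apply: le_trans (ler_wpM2r (normr_ge0 x) TS) _.
  rewrite -[leLHS]mulrA; apply: ler_piMr; first by rewrite divr_ge0// ltW.
  by rewrite mulrC ler_pdivrMr// mul1r lerDl.
pose L x := lim ((fun S : bop E F => S x) @ G).
have cvgL x : (fun S : bop E F => S x) @ G --> L x by exact: cvgx.
have linL : linear L.
  move=> a x y.
  have h : (fun S : bop E F => S (a *: x + y)) @ G --> a *: L x + L y.
    rewrite [X in X @ G --> _](_ : _ = fun S : bop E F => a *: S x + S y).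
      by apply: cvgD => //; exact: cvgZr.
    by apply/funext => S; rewrite linearP.
  exact: cvg_unique (cvgL _) h.
have LG e (T : bop E F) : (\forall S \near G, `|T - S| <= e) ->
    forall x, `|T x - L x| <= e * `|x|.
  move=> GT x; apply/ler_addgt0Pr => d d0; near G => S.
  rewrite -(subrKA (S x)) (le_trans (ler_normD _ _))// lerD//.
    rewrite -bop_subE (le_trans (bop_norm_le _ _))// ler_wpM2r//.
    by near: S.
  rewrite distrC; near: S.
  by have /cvgrPdist_le/(_ _ d0) := cvgL x.
have bL : (L : E -> F) \in @bounded_linear R E F.
  apply/bounded_linearP; split => //.
  have [T /LG LT] := Gapp _ ltr01.
  exists (`|T| + 1) => [|x]; first by rewrite addr_ge0.
  rewrite -(subKr (T x) (L x)) (le_trans (ler_normB _ _))// mulrDl lerD//.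
  exact: bop_norm_le.
exists (Bop bL); apply/cvgrPdist_le => e e0.
have e2 : 0 < e / 2 by rewrite divr_gt0.
have [T GT] := Gapp _ e2.
near=> S; rewrite -(subrKA T) (splitr e) (le_trans (ler_normD _ _))// lerD//.
  apply: opnorm_le => [|x]; first exact: ltW.
  by rewrite bop_subE distrC; exact: LG.
by near: S.
Unshelve. all: by end_near. Qed.

HB.instance Definition _ := Uniform_isComplete.Build (bop E F) bop_cauchy_cvg.

End bop_complete.

Section dual.
Variables (R : realType).

(* The norm is the operator norm of [bop E R]. When [E] is a Banach lattice,
   [dual E] is one too, for the order given by the values on the positive cone,
   so that [modulus], [Order.meet] and [dual (dual E)] make sense on it. *)
Definition dual (E : normedModType R) := bop E R.

HB.instance Definition _ (E : normedModType R) :=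
  CompleteNormedModule.copy (dual E) (bop E R).

Variables (E F : normedModType R).

Lemma dualZ (f : dual E) (a : R) (x : E) : f (a *: x) = a * f x.
Proof. exact: bopZ. Qed.

Lemma adjoint_bounded_linear (T : bop E F) (f : dual F) :
  ((f : F -> R) \o T) \in @bounded_linear R E R.
Proof.
apply/bounded_linearP; split=> [a x y|]; first by rewrite /= !linearP.
exists (`|f| * `|T|) => [|x]; first by rewrite mulr_ge0.
rewrite /= (le_trans (bop_norm_le f _))// -mulrA ler_wpM2l//.
exact: bop_norm_le.
Qed.

Definition adjoint (T : bop E F) (f : dual F) : dual E :=
  Bop (adjoint_bounded_linear T f).

End dual.

Section dual_order.
Variables (R : realType) (E : banachLatticeType R).
Implicit Types (f g h : dual E) (x y z u : E).

Definition dual_le f g : bool := `[< forall x, 0 <= x -> f x <= g x >].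

Lemma dual_leP f g : reflect (forall x, 0 <= x -> f x <= g x) (dual_le f g).
Proof. exact: asboolP. Qed.

Lemma dual_le_refl : reflexive dual_le.
Proof. by move=> f; apply/dual_leP. Qed.

Lemma dual_le_anti : antisymmetric dual_le.
Proof.
move=> f g /andP[/dual_leP fg /dual_leP gf]; apply: bop_ext => x.
have e z : 0 <= z -> f z = g z by move=> z0; apply/le_anti; rewrite fg ?gf.
by rewrite -(pos_partB x) !bopB !e ?pos_part_ge0 ?neg_part_ge0.
Qed.

Lemma dual_le_trans : transitive dual_le.
Proof.
move=> g f h /dual_leP fg /dual_leP gh; apply/dual_leP => x x0.
exact: le_trans (fg x x0) (gh x x0).
Qed.

(* The Riesz-Kantorovich formula gives the positive part of [f] on the cone:
   f^+ x = sup {f y | 0 <= y <= x}. *)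
Definition rk_set f x : set R := [set f y | y in [set y | 0 <= y <= x]].
Definition rk_sup f x : R := sup (rk_set f x).

Lemma rk_ub f x y : 0 <= y <= x -> f y <= `|f| * `|x|.
Proof.
move=> /andP[y0 yx]; apply: le_trans (ler_norm _) _.
by apply: le_trans (bop_norm_le _ _) _; rewrite ler_wpM2l// blat_norm_le.
Qed.

Lemma rk_has_sup f x : 0 <= x -> has_sup (rk_set f x).
Proof.
move=> x0; split; first by exists (f 0), 0 => //=; rewrite lexx.
by exists (`|f| * `|x|) => _ [y /= yx <-]; exact: rk_ub.
Qed.

Lemma rk_sup_ge f x y : 0 <= y <= x -> f y <= rk_sup f x.
Proof.
move=> yx; have x0 : 0 <= x by case/andP: yx; exact: le_trans.
by apply: (sup_upper_bound (rk_has_sup f x0)); exists y.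
Qed.

Lemma rk_sup_le f x M : 0 <= x -> (forall y, 0 <= y <= x -> f y <= M) ->
  rk_sup f x <= M.
Proof.
move=> x0 h; apply: ge_sup; first by have [] := rk_has_sup f x0.
by move=> _ [y /= yx <-]; exact: h.
Qed.

Lemma rk_supD f x y : 0 <= x -> 0 <= y ->
  rk_sup f (x + y) = rk_sup f x + rk_sup f y.
Proof.
move=> x0 y0; apply/le_anti/andP; split.
  apply: rk_sup_le => [|z /andP[z0 zxy]]; first exact: blat_addr_ge0.
  have [u ux zuy] := riesz_decomposition x0 y0 z0 zxy.
  by rewrite -(subrK u z) addrC bopD lerD// rk_sup_ge.
rewrite -lerBrDr; apply: rk_sup_le => // u /andP[u0 ux].
rewrite lerBrDr -lerBrDl; apply: rk_sup_le => // v /andP[v0 vy].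
rewrite lerBrDl -bopD; apply: rk_sup_ge.
by rewrite blat_addr_ge0// blat_leD.
Qed.

Lemma rk_supZ_le f a x : 0 < a -> 0 <= x ->
  rk_sup f (a *: x) <= a * rk_sup f x.
Proof.
move=> a0 x0; apply: rk_sup_le => [|y /andP[y0 yax]].
  by rewrite blat_scaler_ge0// ltW.
rewrite -ler_pdivrMl// -dualZ; apply: rk_sup_ge.
have ai : 0 <= a^-1 by rewrite invr_ge0 ltW.
rewrite blat_scaler_ge0//=; have := blat_scaler_le ai yax.
by rewrite scalerA mulVf ?gt_eqF// scale1r.
Qed.

Lemma rk_supZ f a x : 0 <= a -> 0 <= x ->
  rk_sup f (a *: x) = a * rk_sup f x.
Proof.
rewrite le_eqVlt => /predU1P[<- x0|a0 x0].
  rewrite scale0r mul0r; apply/le_anti/andP; split.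
    by apply: rk_sup_le => // y /le_anti <-; rewrite bop0.
  by rewrite -(bop0 f) rk_sup_ge// lexx.
apply/le_anti; rewrite rk_supZ_le//= -ler_pdivlMl//.
have := @rk_supZ_le f a^-1 (a *: x).
rewrite scalerA mulVf ?gt_eqF// scale1r; apply; first by rewrite invr_gt0.
by rewrite blat_scaler_ge0// ltW.
Qed.

Definition rk_fun f x : R := rk_sup f (pos_part x) - rk_sup f (neg_part x).

Lemma rk_fun_sub f u v : 0 <= u -> 0 <= v ->
  rk_fun f (u - v) = rk_sup f u - rk_sup f v.
Proof.
move=> u0 v0; set w := u - v.
have e : pos_part w + v = u + neg_part w.
  by apply/eqP; rewrite -subr_eq addrAC pos_partB subrK.
apply/eqP; rewrite /rk_fun subr_eq addrAC eq_sym subr_eq.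
by rewrite -!rk_supD ?pos_part_ge0 ?neg_part_ge0// e.
Qed.

Lemma rk_fun_ge0 f x : 0 <= x -> rk_fun f x = rk_sup f x.
Proof.
move=> x0; rewrite -{1}[x]subr0 rk_fun_sub//.
have := @rk_supZ f 0 0 (lexx _) (lexx _).
by rewrite scale0r mul0r => ->; rewrite subr0.
Qed.

Lemma rk_funD f x y : rk_fun f (x + y) = rk_fun f x + rk_fun f y.
Proof.
rewrite -{1}(pos_partB x) -{1}(pos_partB y) addrACA -opprD.
rewrite rk_fun_sub ?blat_addr_ge0 ?pos_part_ge0 ?neg_part_ge0//.
by rewrite !rk_supD ?pos_part_ge0 ?neg_part_ge0// opprD addrACA.
Qed.

Lemma rk_funZ f a x : rk_fun f (a *: x) = a * rk_fun f x.
Proof.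
have pZ b z : 0 <= b -> rk_fun f (b *: z) = b * rk_fun f z.
  move=> b0; rewrite -{1}(pos_partB z) scalerBr.
  rewrite rk_fun_sub ?blat_scaler_ge0 ?pos_part_ge0 ?neg_part_ge0//.
  by rewrite !rk_supZ ?pos_part_ge0 ?neg_part_ge0// mulrBr.
have [a0|/ltW a0] := leP 0 a; first exact: pZ.
have N z : rk_fun f (- z) = - rk_fun f z.
  by rewrite /rk_fun /neg_part opprK opprB.
by rewrite -{1}[a]opprK scaleNr N pZ ?oppr_ge0// mulNr opprK.
Qed.

Lemma rk_sup_ge0 f x : 0 <= x -> 0 <= rk_sup f x.
Proof. by move=> x0; rewrite -(bop0 f) rk_sup_ge// lexx. Qed.

Lemma rk_sup_norm f x : 0 <= x -> rk_sup f x <= `|f| * `|x|.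
Proof. by move=> x0; apply: rk_sup_le => // y; exact: rk_ub. Qed.

Lemma rk_fun_bounded_linear f : (rk_fun f : E -> R) \in @bounded_linear R E R.
Proof.
apply/bounded_linearP; split=> [a x y|]; first by rewrite rk_funD rk_funZ.
exists (`|f|) => // x; rewrite ler_norml /rk_fun; apply/andP; split.
  rewrite lerNl opprB lerBlDr (le_trans (rk_sup_norm _ (neg_part_ge0 _)))//.
  rewrite (@le_trans _ _ (`|f| * `|x|))// ?ler_wpM2l ?norm_neg_part//.
  by rewrite lerDl rk_sup_ge0// pos_part_ge0.
rewrite lerBlDr (le_trans (rk_sup_norm _ (pos_part_ge0 _)))//.
rewrite (@le_trans _ _ (`|f| * `|x|))// ?ler_wpM2l ?norm_pos_part//.
by rewrite lerDl rk_sup_ge0// neg_part_ge0.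
Qed.

Definition dual_pos f : dual E := Bop (rk_fun_bounded_linear f).
Definition dual_join f g : dual E := g + dual_pos (f - g).
Definition dual_meet f g : dual E := - dual_join (- f) (- g).

Lemma dual_joinE f g x : 0 <= x ->
  dual_join f g x = g x + rk_sup (f - g) x.
Proof. by move=> x0; rewrite bop_addE -rk_fun_ge0. Qed.

Lemma dual_leUx f g h : dual_le (dual_join f g) h = dual_le f h && dual_le g h.
Proof.
apply/idP/andP => [/dual_leP H|[/dual_leP fh /dual_leP gh]].
  split; apply/dual_leP => x x0; apply: le_trans (H x x0); rewrite dual_joinE//.
    by rewrite -lerBlDl -bop_subE rk_sup_ge// x0 lexx.
  by rewrite lerDl rk_sup_ge0.
apply/dual_leP => x x0; rewrite dual_joinE// -lerBrDl.
apply: rk_sup_le => // y /andP[y0 yx]; rewrite bop_subE.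
have xy0 : 0 <= x - y by rewrite blat_subr_ge0.
rewrite lerBlDr -{1}(subrK y x) -[x in g x](subrK y) !bopD.
have := lerD (fh y y0) (gh _ xy0); lra.
Qed.

Lemma dual_leN2 f g : dual_le (- f) (- g) = dual_le g f.
Proof.
by apply/dual_leP/dual_leP => H x x0; have := H x x0; rewrite !bop_oppE lerN2.
Qed.

Lemma dual_lexI f g h : dual_le f (dual_meet g h) = dual_le f g && dual_le f h.
Proof. by rewrite -dual_leN2 opprK dual_leUx !dual_leN2. Qed.

Lemma dual_leD2r h f g : dual_le f g -> dual_le (f + h) (g + h).
Proof.
by move=> /dual_leP fg; apply/dual_leP => x x0; rewrite !bop_addE lerD2r fg.
Qed.

Lemma dual_scale_ge0 (a : R) f : 0 <= a -> dual_le 0 f -> dual_le 0 (a *: f).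
Proof.
move=> a0 /dual_leP f0; apply/dual_leP => x x0.
by rewrite bop_scaleE; exact: mulr_ge0 (f0 x x0).
Qed.

Lemma dual_norm_le f g :
  dual_le (dual_join f (- f)) (dual_join g (- g)) -> `|f| <= `|g|.
Proof.
move=> /dual_leP fg; apply: opnorm_le => // x.
have abs_le h u : 0 <= u -> `|h u| <= dual_join h (- h) u.
  move=> u0; have := dual_le_refl (dual_join h (- h)).
  rewrite dual_leUx => /andP[/dual_leP/(_ u u0) h1 /dual_leP/(_ u u0) h2].
  by rewrite ler_norml lerNl h1 h2.
have fx : `|f x| <= dual_join f (- f) (modulus x).
  rewrite -{1}(pos_partB x) modulusE bopB bopD (le_trans (ler_normB _ _))//.
  by rewrite lerD// abs_le ?pos_part_ge0 ?neg_part_ge0.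
apply: le_trans fx _; apply: le_trans (fg _ (modulus_ge0 x)) _.
rewrite dual_joinE ?modulus_ge0// bop_oppE -lerBrDl !opprK.
apply: rk_sup_le => [|y /andP[y0 yx]]; first exact: modulus_ge0.
rewrite bop_addE -lerBlDr -bopD -bopB.
apply: le_trans (ler_norm _) _; apply: le_trans (bop_norm_le _ _) _.
rewrite ler_wpM2l// -[leRHS]norm_modulus; apply: blat_norm_le_abs.
  by rewrite blat_lerBlDr blat_leD.
by rewrite opprB blat_lerBlDr -{1}[modulus x]addr0 blat_leD2l blat_addr_ge0.
Qed.

HB.instance Definition _ := isBanachLattice.Build R (dual E)
  dual_le_refl dual_le_anti dual_le_trans dual_leUx dual_lexI dual_leD2r
  dual_scale_ge0 dual_norm_le.

HB.instance Definition _ :=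
  Order.Lattice.copy (dual E) (BanachLattice.sort (dual E)).

End dual_order.

Section null_sequences.
Variables (R : realType).

Definition weakly_null (E : normedModType R) (x : nat -> E) : Prop :=
  forall f : dual E, f (x n) @[n --> \oo] --> (0 : R).

Definition weak_star_null (E : normedModType R) (f : nat -> dual E) : Prop :=
  forall x : E, f n x @[n --> \oo] --> (0 : R).

Definition norm_null (E : normedModType R) (x : nat -> E) : Prop :=
  `|x n| @[n --> \oo] --> (0 : R).

Definition disjoint_seq (E : banachLatticeType R) (x : nat -> E) : Prop :=
  forall n m, n != m -> Order.meet (modulus (x n)) (modulus (x m)) = 0.

Definition positive_seq (E : banachLatticeType R) (x : nat -> E) : Prop :=
  forall n, 0 <= x n.

Definition seq_weakly_continuous_lattice_ops (E : banachLatticeType R) : Prop :=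
  forall x : nat -> E, weakly_null x -> weakly_null (fun n => modulus (x n)).

Definition dual_seq_weak_star_continuous_lattice_ops
    (F : banachLatticeType R) : Prop :=
  forall f : nat -> dual F,
    weak_star_null f -> weak_star_null (fun n => modulus (f n)).

Definition property_d (F : banachLatticeType R) : Prop :=
  forall f : nat -> dual F, disjoint_seq f ->
    weak_star_null f -> weak_star_null (fun n => modulus (f n)).

End null_sequences.

Section operator_classes.
Variables (R : realType) (E F : banachLatticeType R).

Definition positive_op (T : bop E F) : Prop := forall x : E, 0 <= x -> 0 <= T x.

Definition op_le (S T : bop E F) : Prop := positive_op (T - S).

Definition domination_property (P : set (bop E F)) : Prop :=
  forall S T : bop E F, op_le 0 S -> op_le S T -> P T -> P S.

Definition PSP : set (bop E F) := [set T | forall x : nat -> E,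
  positive_seq x -> weakly_null x -> norm_null (fun n => T (x n))].

Definition DPSP : set (bop E F) := [set T | forall f : nat -> dual F,
  positive_seq f -> weak_star_null f -> norm_null (fun n => adjoint T (f n))].

Definition DDSP : set (bop E F) := [set T | forall f : nat -> dual F,
  disjoint_seq f -> weak_star_null f -> norm_null (fun n => adjoint T (f n))].

Definition PGP : set (bop E F) := [set T | forall f : nat -> dual F,
  positive_seq f -> weak_star_null f -> weakly_null (fun n => adjoint T (f n))].

Definition DGP : set (bop E F) := [set T | forall f : nat -> dual F,
  disjoint_seq f -> weak_star_null f -> weakly_null (fun n => adjoint T (f n))].

Definition dswl : set (bop E F) := [set T | forall x : nat -> E,
  disjoint_seq x -> weakly_null x -> weakly_null (fun n => modulus (T (x n)))].

Definition swl : set (bop E F) := [set T | forall x : nat -> E,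
  weakly_null x -> weakly_null (fun n => modulus (T (x n)))].

Definition swsl : set (bop E F) := [set T | forall f : nat -> dual F,
  weak_star_null f -> weak_star_null (fun n => modulus (adjoint T (f n)))].

Definition d_op : set (bop E F) := [set T | forall f : nat -> dual F,
  disjoint_seq f -> weak_star_null f ->
  weak_star_null (fun n => modulus (adjoint T (f n)))].

Definition bi_sP : set (bop E F) :=
  [set T | forall (f : nat -> dual F) (x : nat -> E),
    positive_seq f -> weak_star_null f -> disjoint_seq x -> weakly_null x ->
    f n (T (x n)) @[n --> \oo] --> (0 : R)].

End operator_classes.

(* Main.v *)
Require Import Defs.
From mathcomp Require Import all_boot all_order all_algebra.
From mathcomp Require Import all_classical all_reals topology normedtype sequences.

(** Let [0 <= S <= T]. For all [x] in [E] and all [f] in the dual of [F],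
    [|S x| <= T |x|] and [|S' f| <= T' |f|] (lemmas [dominated_modulus_le] and
    [adjoint_modulus_le]). Each kind of nullity (in norm, weak, weak star, or of
    scalars) passes from a sequence to every sequence whose moduli it bounds, so
    the property of [T], applied to the sequence of moduli, gives the property
    of [S]. It remains to know that the moduli form an admissible test sequence
    for [T].

    For positive test sequences the moduli are the sequence itself. For the
    remaining classes of functionals, and for arbitrary weakly null sequences in
    [E], the hypothesis on [F] or [E] says that taking moduli preserves nullity;
    moduli of a disjoint sequence are disjoint as well.

    The classes tested on disjoint weakly null sequences of [E] come with no
    hypothesis on [E]: there one needs that in every Banach lattice the moduli
    of a disjoint weakly null sequence are weakly null
    ([disjoint_weakly_null_modulus]). By linearity it suffices to show that
    [f (x_n^+)] tends to [0] for [f >= 0]. Put, for [y >= 0],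
      [g y = sup {f z | 0 <= z <= y, z disjoint from every x_m^-}],
    the component of [f] that is carried by the elements disjoint from all the
    negative parts. The Riesz decomposition property makes [g] additive, so it
    extends to a bounded functional. Since the [x_n] are disjoint, every [x_n^+]
    is disjoint from every [x_m^-], whence [g (x_n^+) = f (x_n^+)] and
    [g (x_n^-) = 0]. Thus [f (x_n^+) = g (x_n)] for the single functional [g],
    and this tends to [0] by weak nullity. *)

Set Implicit Arguments.
Unset Strict Implicit.
Unset Printing Implicit Defensive.

Import Order.TTheory GRing.Theory Num.Theory.
Import numFieldNormedType.Exports.

Local Open Scope classical_set_scope.
Local Open Scope ring_scope.

(** * Moduli and functionals *)

Section modulus_estimates.
Variables (R : realType) (E : banachLatticeType R).
Implicit Types (x y : E) (f g : dual E).

Lemma modulus_id x : modulus (modulus x) = modulus x.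
Proof. exact/ge0_modulus/modulus_ge0. Qed.

Lemma blat_norm_le_modulus x y : modulus x <= y -> `|x| <= `|y|.
Proof. by move=> xy; rewrite -norm_modulus blat_norm_le ?modulus_ge0. Qed.

Lemma dual_le_apply f g x : f <= g -> 0 <= x -> f x <= g x.
Proof. by move=> /dual_leP; exact. Qed.

Lemma dual_ge0_apply f x : 0 <= f -> 0 <= x -> 0 <= f x.
Proof. by move=> f0 x0; exact: (dual_le_apply f0 x0). Qed.

Lemma dual_ge0_le f x y : 0 <= f -> x <= y -> f x <= f y.
Proof.
by move=> f0; rewrite -blat_subr_ge0 => /(dual_ge0_apply f0); rewrite bopB subr_ge0.
Qed.

(** On the cone this is the definition of the modulus of [f]; the general case
    splits [x] into its positive and negative parts. *)
Lemma dual_abs_le f x : `|f x| <= modulus f (modulus x).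
Proof.
have abs_le u : 0 <= u -> `|f u| <= modulus f u.
  move=> u0; rewrite ler_norml lerNl -bop_oppE.
  by rewrite !dual_le_apply ?modulus_ge ?modulus_geN.
rewrite -[x in f x]pos_partB (modulusE x) bopB bopD (le_trans (ler_normB _ _))//.
by rewrite lerD// abs_le ?pos_part_ge0 ?neg_part_ge0.
Qed.

End modulus_estimates.

(** * Null sequences dominated through their moduli *)

Section null_domination.
Variables (R : realType) (E : banachLatticeType R).

Lemma cvg0_dominated (u v : nat -> R) : (forall n, `|u n| <= v n) ->
  v n @[n --> \oo] --> 0 -> u n @[n --> \oo] --> 0.
Proof.
move=> uv v0; apply: (@squeeze_cvgr _ _ _ _ (fun n => - v n) v) => //.
  by apply: nearW => n; rewrite -ler_norml.
by rewrite -oppr0; exact: cvgN.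
Qed.

Lemma norm_null_dominated (x y : nat -> E) :
  (forall n, modulus (x n) <= y n) -> norm_null y -> norm_null x.
Proof.
move=> xy; apply: cvg0_dominated => n.
by rewrite normr_id blat_norm_le_modulus.
Qed.

Lemma weakly_null_dominated (x y : nat -> E) :
  (forall n, modulus (x n) <= y n) -> weakly_null y -> weakly_null x.
Proof.
move=> xy y0 f; apply: cvg0_dominated (y0 (modulus f)) => n.
by rewrite (le_trans (dual_abs_le _ _))// dual_ge0_le ?modulus_ge0.
Qed.

Lemma weak_star_null_dominated (f g : nat -> dual E) :
  (forall n, modulus (f n) <= g n) -> weak_star_null g -> weak_star_null f.
Proof.
move=> fg g0 x; apply: cvg0_dominated (g0 (modulus x)) => n.
by rewrite (le_trans (dual_abs_le _ _))// dual_le_apply ?modulus_ge0.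
Qed.

Lemma disjoint_seq_modulus (x : nat -> E) :
  disjoint_seq x -> disjoint_seq (fun n => modulus (x n)).
Proof. by move=> dx n m nm; rewrite !modulus_id dx. Qed.

End null_domination.

(** * The component of a positive functional on a solid cone *)

Section carrier_component.
Variables (R : realType) (E : banachLatticeType R).
Variables (f : dual E) (B : set E).
Implicit Types (x y z : E).
Hypothesis f0 : 0 <= f.
Hypothesis B0 : B 0.
Hypothesis BD : forall x y, B x -> B y -> B (x + y).
Hypothesis BZ : forall (a : R) x, 0 <= a -> B x -> B (a *: x).
Hypothesis Bsolid : forall x y, 0 <= x -> x <= y -> B y -> B x.

(** The Riesz-Kantorovich supremum with the competitors confined to the solid
    cone [B]: the least positive function on the positive cone that is monotone
    and agrees with [f] on [B]. *)
Definition carrier_sup (x : E) : R :=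
  sup [set f z | z in [set z | B z /\ 0 <= z <= x]].

Lemma carrier_sup_ge x z : B z -> 0 <= z <= x -> f z <= carrier_sup x.
Proof.
move=> Bz zx; apply: sup_upper_bound; last by exists z.
split; first by exists (f z), z.
by exists (f x) => _ [y [_ /andP[_ yx]] <-]; exact: dual_ge0_le.
Qed.

Lemma carrier_sup_le x M : 0 <= x ->
  (forall z, B z -> 0 <= z <= x -> f z <= M) -> carrier_sup x <= M.
Proof.
move=> x0 h; apply: ge_sup; first by exists (f 0), 0; rewrite //= lexx.
by move=> _ [z [Bz zx] <-]; exact: h.
Qed.

Lemma carrier_sup_ge0 x : 0 <= x -> 0 <= carrier_sup x.
Proof. by move=> x0; rewrite -(bop0 f) carrier_sup_ge ?lexx. Qed.

Lemma carrier_sup_le_dual x : 0 <= x -> carrier_sup x <= f x.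
Proof. by move=> x0; apply: carrier_sup_le => // z _ /andP[_]; exact: dual_ge0_le. Qed.

(** Solidity of [B] is what keeps both pieces of a Riesz decomposition of a
    competitor for [x + y] inside [B]; closure under sums gives the converse
    inequality. *)
Lemma carrier_supD x y : 0 <= x -> 0 <= y ->
  carrier_sup (x + y) = carrier_sup x + carrier_sup y.
Proof.
move=> x0 y0; apply/le_anti/andP; split.
  apply: carrier_sup_le => [|z Bz /andP[z0 zxy]]; first exact: blat_addr_ge0.
  have [u /andP[u0 ux] /andP[v0 vy]] := riesz_decomposition x0 y0 z0 zxy.
  have uz : u <= z by rewrite -blat_subr_ge0.
  have vz : z - u <= z by rewrite blat_lerBlDr -{1}[z]addr0 blat_leD2l.
  rewrite -(subrK u z) addrC bopD lerD// carrier_sup_ge ?u0 ?v0//.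
    exact: Bsolid Bz.
  exact: Bsolid Bz.
rewrite -lerBrDr; apply: carrier_sup_le => // u Bu /andP[u0 ux].
rewrite lerBrDr -lerBrDl; apply: carrier_sup_le => // v Bv /andP[v0 vy].
rewrite lerBrDl -bopD; apply: carrier_sup_ge; first exact: BD.
by rewrite blat_addr_ge0// blat_leD.
Qed.

Lemma carrier_supZ_ge (a : R) x : 0 <= a -> 0 <= x ->
  a * carrier_sup x <= carrier_sup (a *: x).
Proof.
rewrite le_eqVlt => /predU1P[<- x0|a0 x0].
  by rewrite mul0r scale0r carrier_sup_ge0.
rewrite -ler_pdivlMl//; apply: carrier_sup_le => // z Bz /andP[z0 zx].
rewrite ler_pdivlMl// -dualZ; apply: carrier_sup_ge; first exact: BZ (ltW a0) Bz.
by rewrite blat_scaler_ge0 ?blat_scaler_le// ltW.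
Qed.

(** The opposite inequality is [carrier_supZ_ge] for the inverse scalar. *)
Lemma carrier_supZ (a : R) x : 0 < a -> 0 <= x ->
  carrier_sup (a *: x) = a * carrier_sup x.
Proof.
move=> a0 x0; apply/le_anti; rewrite carrier_supZ_ge ?(ltW a0)// andbT.
rewrite -ler_pdivrMl//.
rewrite (le_trans (carrier_supZ_ge _ _)) ?invr_ge0 ?blat_scaler_ge0 ?(ltW a0)//.
by rewrite scalerA mulVf ?gt_eqF// scale1r.
Qed.

End carrier_component.

(** * Extending additive functions from the positive cone *)

Section cone_extension.
Variables (R : realType) (E : banachLatticeType R).
Variables (f : dual E) (p : E -> R).
Implicit Types (x y u v : E).
Hypothesis pD : forall x y, 0 <= x -> 0 <= y -> p (x + y) = p x + p y.
Hypothesis pZ : forall (a : R) x, 0 < a -> 0 <= x -> p (a *: x) = a * p x.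
Hypothesis p_ge0 : forall x, 0 <= x -> 0 <= p x.
Hypothesis p_le : forall x, 0 <= x -> p x <= f x.

Definition cone_ext (x : E) : R := p (pos_part x) - p (neg_part x).

(** The value depends only on the difference [u - v]: two ways of writing it as
    a difference of positive elements have equal cross sums, on which [p] is
    additive. *)
Lemma cone_ext_sub u v : 0 <= u -> 0 <= v -> cone_ext (u - v) = p u - p v.
Proof.
move=> u0 v0; set w := u - v.
have e : pos_part w + v = u + neg_part w.
  by apply/eqP; rewrite -subr_eq addrAC pos_partB subrK.
apply/eqP; rewrite /cone_ext subr_eq addrAC eq_sym subr_eq.
by rewrite -!pD ?pos_part_ge0 ?neg_part_ge0// e.
Qed.

Lemma cone_ext_ge0 x : 0 <= x -> cone_ext x = p x.
Proof.
move=> x0; rewrite -[x in LHS]subr0 cone_ext_sub//.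
have /eqP := pD (lexx (0 : E)) (lexx 0).
by rewrite addr0 -[X in X == _]addr0 (inj_eq (addrI _)) => /eqP <-; rewrite subr0.
Qed.

(** Boundedness costs nothing beyond domination by [f]: the absolute value at
    [x] is at most [p |x|], hence at most [f |x|]. *)
Lemma cone_ext_bounded_linear : (cone_ext : E -> R) \in @bounded_linear R E R.
Proof.
have D x y : cone_ext (x + y) = cone_ext x + cone_ext y.
  rewrite -[x in LHS]pos_partB -[y in LHS]pos_partB addrACA -opprD.
  rewrite cone_ext_sub ?blat_addr_ge0 ?pos_part_ge0 ?neg_part_ge0//.
  by rewrite !pD ?pos_part_ge0 ?neg_part_ge0// opprD addrACA.
have N x : cone_ext (- x) = - cone_ext x.
  by rewrite /cone_ext /neg_part opprK opprB.
have pos_Z (a : R) (x : E) : 0 < a -> cone_ext (a *: x) = a * cone_ext x.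
  move=> a0; rewrite -[x in LHS]pos_partB scalerBr.
  rewrite cone_ext_sub ?blat_scaler_ge0 ?pos_part_ge0 ?neg_part_ge0 ?(ltW a0)//.
  by rewrite !pZ ?pos_part_ge0 ?neg_part_ge0// -mulrBr.
have Z (a : R) (x : E) : cone_ext (a *: x) = a * cone_ext x.
  have [a0|a0|<-] := ltgtP 0 a; first exact: pos_Z.
    by rewrite -[a]opprK scaleNr N pos_Z ?oppr_gt0// [in RHS]mulNr.
  by rewrite scale0r mul0r /cone_ext /neg_part oppr0 subrr.
apply/bounded_linearP; split=> [a x y|]; first by rewrite D Z.
exists (`|f|) => // x.
have pE : p (modulus x) = p (pos_part x) + p (neg_part x).
  by rewrite modulusE pD ?pos_part_ge0 ?neg_part_ge0.
apply: (@le_trans _ _ (p (modulus x))).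
  rewrite pE (le_trans (ler_normB _ _))//.
  by rewrite !ger0_norm ?p_ge0 ?pos_part_ge0 ?neg_part_ge0.
apply: le_trans (p_le (modulus_ge0 x)) _; apply: le_trans (ler_norm _) _.
by rewrite -[in leRHS](norm_modulus x) bop_norm_le.
Qed.

End cone_extension.

(** * Moduli of disjoint weakly null sequences *)

Section disjoint_weakly_null.
Variables (R : realType) (E : banachLatticeType R).
Implicit Types (x y z w : E) (f g : dual E).

(** With [m] the meet, [x^+ - m] is still an upper bound of [x] and [0], as
    [x = x^+ - x^-] and [m <= x^-]; minimality of [x^+] forces [m <= 0]. *)
Lemma pos_neg_disjoint x : Order.meet (pos_part x) (neg_part x) = 0.
Proof.
set m := Order.meet _ _.
apply/le_anti/andP; split; last by rewrite lexI pos_part_ge0 neg_part_ge0.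
have : pos_part x <= pos_part x - m.
  rewrite {1}/pos_part leUx blat_subr_ge0 leIl andbT.
  by rewrite -{1}(pos_partB x) blat_leD2l blat_leN2 leIr.
by rewrite -{1}[pos_part x]addr0 blat_leD2l -blat_oppr_le0 opprK.
Qed.

(** For positive elements, [z] disjoint from [w i] means that only [0] lies
    between [0] and both of them. This form, free of meets, is the one that
    combines with the Riesz decomposition. *)
Definition disjoint_cone (I : Type) (w : I -> E) : set E :=
  [set z | 0 <= z /\ forall i t, 0 <= t -> t <= z -> t <= w i -> t = 0].

Lemma disjoint_coneD (I : Type) (w : I -> E) x y :
  disjoint_cone w x -> disjoint_cone w y -> disjoint_cone w (x + y).
Proof.
move=> [x0 xw] [y0 yw]; split=> [|i t t0 txy tw]; first exact: blat_addr_ge0.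
have [u /andP[u0 ux] /andP[v0 vy]] := riesz_decomposition x0 y0 t0 txy.
have ut : u <= t by rewrite -blat_subr_ge0.
have u_eq0 := xw i u u0 ux (le_trans ut tw).
by move: vy; rewrite u_eq0 subr0 => ty; exact: yw ty tw.
Qed.

Lemma disjoint_coneZ (I : Type) (w : I -> E) (a : R) x :
  0 <= a -> disjoint_cone w x -> disjoint_cone w (a *: x).
Proof.
move=> a0 [x0 xw]; split=> [|i t t0 tax tw]; first exact: blat_scaler_ge0.
(* Dividing by a number at least [a] and at least [1] brings [t] below both
   [x] and [w i]. *)
have b0 : 0 < a + 1 by rewrite ltr_wpDl.
have bi0 : 0 <= (a + 1)^-1 by rewrite invr_ge0 ltW.
have le_scale (c d : R) z : 0 <= z -> c <= d -> c *: z <= d *: z.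
  by move=> z0 cd; rewrite -blat_subr_ge0 -scalerBl blat_scaler_ge0 ?subr_ge0.
have : (a + 1)^-1 *: t = 0.
  apply: xw; first exact: blat_scaler_ge0.
    apply: le_trans (blat_scaler_le bi0 tax) _.
    rewrite scalerA -[leRHS]scale1r le_scale// ler_pdivrMl// mulr1 lerDl//.
  apply: le_trans tw; rewrite -[leRHS]scale1r le_scale// invf_le1// lerDr//.
by move=> /eqP; rewrite scaler_eq0 invr_eq0 gt_eqF//= => /eqP.
Qed.

(** A positive functional can be cut off at a family of positive elements without
    changing it on the elements disjoint from that family: the component of [f]
    on the disjoint cone kills each [w i], because no nonzero competitor lies
    below [w i]. *)
Lemma disjoint_cone_functional (I : Type) (w : I -> E) f : 0 <= f ->
  exists g, (forall z, disjoint_cone w z -> g z = f z) /\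
            (forall i, 0 <= w i -> g (w i) = 0).
Proof.
move=> f0; pose B := disjoint_cone w; pose p := carrier_sup f B.
have B0 : B 0 by split=> // i t t0 tle0 _; apply/le_anti; rewrite tle0.
have Bsolid x y : 0 <= x -> x <= y -> B y -> B x.
  move=> x0 xy [y0 yw]; split=> // i t t0 tx; apply: yw => //.
  exact: le_trans xy.
have BD := @disjoint_coneD I w; have BZ := @disjoint_coneZ I w.
have pD := carrier_supD f0 B0 BD Bsolid; have pZ := carrier_supZ f0 B0 BZ.
have p_ge0 := carrier_sup_ge0 f0 B0; have p_le := carrier_sup_le_dual f0 B0.
exists (Bop (cone_ext_bounded_linear pD pZ p_ge0 p_le)).
have gE x : 0 <= x -> cone_ext p x = p x by exact: cone_ext_ge0.
split=> [z Bz|i wi0] /=; rewrite gE//; try by case: Bz.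
  have z0 : 0 <= z by case: Bz.
  by apply/le_anti; rewrite p_le//= carrier_sup_ge// z0 lexx.
apply/le_anti; rewrite p_ge0// andbT; apply: carrier_sup_le => //.
by move=> z [_ zw] /andP[z0 zwi]; rewrite (zw i z)// bop0.
Qed.

(** Cutting [f] off at all the negative parts at once gives one functional [g]
    with [g (x n) = f (pos_part (x n))] for every [n]. *)
Lemma disjoint_weakly_null_pos_part (x : nat -> E) f : 0 <= f ->
  disjoint_seq x -> weakly_null x -> f (pos_part (x n)) @[n --> \oo] --> 0.
Proof.
move=> f0 dx x0.
have [g [gf gw]] := disjoint_cone_functional (fun n => neg_part (x n)) f0.
rewrite (_ : (fun n => _) = (fun n => g (x n))); first exact: x0.
apply/funext => n.
rewrite -[x n in RHS]pos_partB bopB gw ?neg_part_ge0// subr0 gf//.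
split=> [|m t t0 tn tm]; first exact: pos_part_ge0.
apply/le_anti; rewrite t0 andbT.
have [nm|nm] := eqVneq n m.
  by rewrite -(pos_neg_disjoint (x n)) lexI tn nm.
rewrite -(dx n m nm) lexI !modulusE (le_trans tn)/=.
  rewrite (le_trans tm)// -[leLHS]add0r blat_leD2r; exact: pos_part_ge0.
rewrite -[leLHS]addr0 blat_leD2l; exact: neg_part_ge0.
Qed.

(** The modulus is the sum of the positive parts of [x n] and [- x n], and both
    sequences are disjoint and weakly null. *)
Lemma disjoint_weakly_null_modulus (x : nat -> E) :
  disjoint_seq x -> weakly_null x -> weakly_null (fun n => modulus (x n)).
Proof.
move=> dx x0 f; apply: (@cvg0_dominated _ _ (fun n => modulus f (modulus (x n)))).
  by move=> n; rewrite -[X in modulus f X]modulus_id dual_abs_le.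
have dNx : disjoint_seq (fun n => - x n).
  by move=> n m nm; rewrite !modulusN dx.
have Nx0 : weakly_null (fun n => - x n).
  move=> h; rewrite (_ : (fun n => _) = (fun n => - h (x n))).
    by rewrite -oppr0; apply: cvgN; exact: x0.
  by apply/funext => n; rewrite bopN.
rewrite (_ : (fun n => _) = (fun n => modulus f (pos_part (x n)) +
    modulus f (pos_part (- x n)))).
  rewrite -[X in _ --> X]addr0.
  by apply: cvgD; apply: disjoint_weakly_null_pos_part => //; exact: modulus_ge0.
by apply/funext => n; rewrite (modulusE (x n)) bopD.
Qed.

End disjoint_weakly_null.

(** * Moduli under dominated operators and their adjoints *)

Section operator_domination.
Variables (R : realType) (E F : banachLatticeType R).
Variables (S T : bop E F).
Hypothesis (S_ge0 : op_le 0 S) (ST : op_le S T).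
Implicit Types x : E.

Lemma dominated_apply_ge0 x : 0 <= x -> 0 <= S x.
Proof. by move=> /S_ge0; rewrite bop_subE bop_zeroE subr0. Qed.

Lemma dominated_apply_le x : 0 <= x -> S x <= T x.
Proof. by move=> /ST; rewrite bop_subE blat_subr_ge0. Qed.

Lemma dominated_modulus_le x : modulus (S x) <= T (modulus x).
Proof.
apply: le_trans (dominated_apply_le (modulus_ge0 x)).
rewrite leUx -bopN -![S _ <= _]blat_subr_ge0 -!bopB.
by rewrite !dominated_apply_ge0// blat_subr_ge0 ?modulus_ge ?modulus_geN.
Qed.

Lemma adjoint_modulus_le (f : dual F) :
  modulus (adjoint S f) <= adjoint T (modulus f).
Proof.
have le_ST x : 0 <= x -> modulus f (S x) <= modulus f (T x).
  by move=> x0; rewrite dual_ge0_le ?modulus_ge0 ?dominated_apply_le.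
rewrite leUx; apply/andP; split; apply/dual_leP => x x0;
  apply: le_trans (le_ST x x0); have Sx0 := dominated_apply_ge0 x0.
  exact: dual_le_apply (modulus_ge f) Sx0.
exact: dual_le_apply (modulus_geN f) Sx0.
Qed.

End operator_domination.

(** * The domination property *)

Theorem theorem3p2p3 (R : realType) (E F : banachLatticeType R) :
  domination_property (@PSP R E F) /\
  domination_property (@DPSP R E F) /\
  (property_d F -> domination_property (@DDSP R E F)) /\
  domination_property (@PGP R E F) /\
  (property_d F -> domination_property (@DGP R E F)) /\
  domination_property (@dswl R E F) /\
  (seq_weakly_continuous_lattice_ops E -> domination_property (@swl R E F)) /\
  (dual_seq_weak_star_continuous_lattice_ops F ->
    domination_property (@swsl R E F)) /\
  (property_d F -> domination_property (@d_op R E F)) /\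
  domination_property (@bi_sP R E F).
Proof.
repeat split.
- move=> S T S0 ST PT x xp x0; apply: norm_null_dominated (PT x xp x0) => n.
  by rewrite -[X in T X](ge0_modulus (xp n)) dominated_modulus_le.
- move=> S T S0 ST PT f fp f0; apply: norm_null_dominated (PT f fp f0) => n.
  by rewrite -[X in adjoint T X](ge0_modulus (fp n)) adjoint_modulus_le.
- move=> Fd S T S0 ST PT f df f0.
  apply: norm_null_dominated (PT _ (disjoint_seq_modulus df) (Fd f df f0)) => n.
  exact: adjoint_modulus_le.
- move=> S T S0 ST PT f fp f0; apply: weakly_null_dominated (PT f fp f0) => n.
  by rewrite -[X in adjoint T X](ge0_modulus (fp n)) adjoint_modulus_le.
- move=> Fd S T S0 ST PT f df f0.
  apply: weakly_null_dominated (PT _ (disjoint_seq_modulus df) (Fd f df f0)) => n.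
  exact: adjoint_modulus_le.
- move=> S T S0 ST PT x dx x0.
  have := PT _ (disjoint_seq_modulus dx) (disjoint_weakly_null_modulus dx x0).
  apply: weakly_null_dominated => n; rewrite modulus_id.
  exact: le_trans (dominated_modulus_le S0 ST _) (modulus_ge _).
- move=> Ew S T S0 ST PT x x0; have := PT _ (Ew x x0).
  apply: weakly_null_dominated => n; rewrite modulus_id.
  exact: le_trans (dominated_modulus_le S0 ST _) (modulus_ge _).
- move=> Fw S T S0 ST PT f f0; have := PT _ (Fw f f0).
  apply: weak_star_null_dominated => n; rewrite modulus_id.
  exact: le_trans (adjoint_modulus_le S0 ST _) (modulus_ge _).
- move=> Fd S T S0 ST PT f df f0.
  have := PT _ (disjoint_seq_modulus df) (Fd f df f0).
  apply: weak_star_null_dominated => n; rewrite modulus_id.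
  exact: le_trans (adjoint_modulus_le S0 ST _) (modulus_ge _).
move=> S T S0 ST PT f x fp f0 dx x0.
have := PT f _ fp f0 (disjoint_seq_modulus dx)
  (disjoint_weakly_null_modulus dx x0).
apply: cvg0_dominated => n; apply: le_trans (dual_abs_le _ _) _.
rewrite (ge0_modulus (fp n)); apply: dual_ge0_le (fp n) _.
exact: dominated_modulus_le.
Qed.
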